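(* Let $m$ and $t$ be positive integers with $\binom{t-1}{4}\le m\le\binom{t-1}{4}+\binom{\lfloor (t-2)/2\rfloor}{3}$. Let $G$ be a $4$-graph with $m$ edges containing a clique of order $t-1$. Then $\lambda(G)=\lambda([t-1]^{(4)})$.
   Context: A $4$-graph $G$ has vertex set $[n]$ and edge set $E\subseteq[n]^{(4)}$ ($4$-element subsets); a clique of order $p$ is a set of $p$ vertices all of whose $4$-subsets are edges; $[p]^{(4)}$ is the complete $4$-graph on $[p]$. For $\vec x\in\mathbb R^n$, $\lambda(G,\vec x)=\sum_{i_1i_2i_3i_4\in E}x_{i_1}x_{i_2}x_{i_3}x_{i_4}$, and the Lagrangian is $\lambda(G)=\max\{\lambda(G,\vec x): x_i\ge0,\ \sum_ix_i=1\}$. *)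

(* Defs.v *)
From HB Require Import structures.
From mathcomp Require Import all_boot all_order all_algebra.
From mathcomp Require Import all_classical all_reals all_analysis.

Set Implicit Arguments.
Unset Strict Implicit.
Unset Printing Implicit Defensive.

Import Order.TTheory GRing.Theory Num.Theory.
Import numFieldNormedType.Exports.

Local Open Scope classical_set_scope.
Local Open Scope ring_scope.

(* An r-graph on the vertex set 'I_n (playing the role of [n]) is its edge set
   G : {set {set 'I_n}}, subject to [uniform r G]. *)
Definition uniform (r n : nat) (G : {set {set 'I_n}}) : Prop :=
  forall e : {set 'I_n}, e \in G -> #|e| = r.

Definition complete (r p : nat) : {set {set 'I_p}} :=
  [set e : {set 'I_p} | #|e| == r]%SET.

Definition is_clique (r n : nat) (G : {set {set 'I_n}}) (K : {set 'I_n}) : Prop :=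
  forall e : {set 'I_n}, e \subset K -> #|e| = r -> e \in G.

Definition has_clique (r n : nat) (G : {set {set 'I_n}}) (p : nat) : Prop :=
  exists2 K : {set 'I_n}, #|K| = p & is_clique r G K.

Definition edge_poly (R : realType) (n : nat) (G : {set {set 'I_n}})
    (x : 'rV[R]_n) : R :=
  \sum_(e in G) \prod_(i in e) x ord0 i.

Definition std_simplex (R : realType) (n : nat) : set 'rV[R]_n :=
  [set x | (forall i, 0 <= x ord0 i) /\ \sum_i x ord0 i = 1].
Arguments std_simplex R n : clear implicits.

(* For n > 0 this supremum is a maximum, see [lagrangian_max] below; for n = 0
   the simplex is empty and the value is 0 by the convention on [sup]. *)
Definition lagrangian (R : realType) (n : nat) (G : {set {set 'I_n}}) : R :=
  sup [set edge_poly G x | x in std_simplex R n].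
Arguments lagrangian R {n} G.

Lemma std_simplex_neq0 (R : realType) (n : nat) :
  (0 < n)%N -> std_simplex R n !=set0.
Proof.
case: n => // n _; exists (delta_mx 0 0); split=> [i|].
  by rewrite mxE ler0n.
rewrite (bigD1 ord0) //= mxE !eqxx big1 ?addr0 // => i i0.
by rewrite mxE (negPf i0) andbF.
Qed.

Lemma std_simplex_compact (R : realType) (n : nat) : compact (std_simplex R n).
Proof.
have cube : compact [set x : 'rV[R]_n | forall i, `[0, 1]%classic (x ord0 i)].
  apply: (@rV_compact R n (fun=> `[0, 1]%classic)) => _.
  exact: segment_compact.
apply: subclosed_compact cube _.
  rewrite (_ : std_simplex R n =
      (\bigcap_i [set x : 'rV[R]_n | 0 <= x ord0 i]) `&`
      [set x | \sum_i x ord0 i = 1]); last first.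
    by apply/seteqP; split=> x [x0 x1]; split=> // i; [move=> _|]; exact: x0.
  apply: closedI.
    apply: closed_bigI => i _.
    apply: (preimage_closed (f := fun x : 'rV[R]_n => x ord0 i)
      (D := [set y | 0 <= y])) => [x _|]; last exact: closed_ge.
    exact: coord_continuous.
  apply: (preimage_closed (f := fun x : 'rV[R]_n => \sum_i x ord0 i)
    (D := [set 1])) => [x _|]; last exact: closed_eq.
  apply: continuous_big => [|i _]; first exact: add_continuous.
  exact: coord_continuous.
move=> x [x0 x1] i /=; rewrite in_itv /= x0 /= -x1 (bigD1 i) //= lerDl.
by apply: sumr_ge0.
Qed.

Lemma edge_poly_continuous (R : realType) (n : nat) (G : {set {set 'I_n}}) :
  continuous (@edge_poly R n G).
Proof.
apply: continuous_big => [|e _]; first exact: add_continuous.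
apply: continuous_big => [|i _]; first exact: mul_continuous.
exact: coord_continuous.
Qed.

Lemma lagrangian_max (R : realType) (n : nat) (G : {set {set 'I_n}}) :
  (0 < n)%N ->
  exists2 x, std_simplex R n x & edge_poly G x = lagrangian R G /\
    forall y, std_simplex R n y -> edge_poly G y <= edge_poly G x.
Proof.
move=> n0.
have [|x /set_mem xS xmax] := EVT_max_rV (f := @edge_poly R n G)
  (std_simplex_neq0 R n0) (@std_simplex_compact R n).
  by apply: continuous_subspaceT; exact: edge_poly_continuous.
have xub y : std_simplex R n y -> edge_poly G y <= edge_poly G x.
  by move=> yS; apply: xmax; apply/mem_set.
exists x => //; split=> //; apply/eqP; rewrite eq_le; apply/andP; split.
  apply: ub_le_sup; last by exists x.
  by exists (edge_poly G x) => _ [y yS <-]; exact: xub.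
apply: ge_sup; first by exists (edge_poly G x), x.
by move=> _ [y yS <-]; exact: xub.
Qed.

(* Main.v *)
Require Import Defs.
From mathcomp Require Import all_boot all_order all_algebra.
From mathcomp Require Import all_classical all_reals all_analysis.
From mathcomp Require Import ring lra zify.

Set Implicit Arguments.
Unset Strict Implicit.
Unset Printing Implicit Defensive.

Import Order.TTheory GRing.Theory Num.Theory.

Local Open Scope ring_scope.

(** Put p = t - 1, let K be the clique, let x be an optimal weight vector and
    l the Lagrangian of G. If x lives on K there is nothing to prove. Otherwise
    some v outside K has x_v > 0, so the partial derivative at v, which is the
    sum of x_T over the link of v, is at least 4 l. That link has at most
    C(q, 3) triples with q = floor((p - 1) / 2), because no edge through v lies
    in K; by Cauchy-Schwarz (4 l)^2 <= C(q, 3) e_3(x^2) <= C(q, 3) a^6 / 6,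
    where a is the Euclidean norm of x. As l >= C(p, 4) / p^4, this forces
    a^2 >= 1.85 / p. On the other hand l <= e_4(x), and by Newton's identities
    24 e_4(x) <= (1 - a)^3 (1 + 3 a), which for such a is smaller than
    24 C(p, 4) / p^4: the weights are too uneven. *)

(** * Polynomial inequalities behind the final contradiction *)

(* Here w stands for 1 / p and b for the sum of squares of the weights. *)
Lemma second_moment_ge (R : realFieldType) (w b : R) :
  0 <= w -> 7 * w <= 1 -> 0 <= b ->
  8 * ((1 - w) * (1 - 2 * w) ^+ 2 * (1 - 3 * w)) * w ^+ 3 <= (1 - 5 * w) * b ^+ 3 ->
  37 * w <= 20 * b.
Proof.
move=> w0 w1 b0 h; rewrite leNgt; apply/negP => hb.
(* Cubing [hb] and cancelling [w ^+ 3] leaves an inequality in [w] alone, which fails on the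
   interval from 0 to 1/7. *)
have b3 : b ^+ 3 <= (37 / 20 * w) ^+ 3 by rewrite lerXn2r ?nnegrE //; lra.
have w_gt0 : 0 < w by lra.
have h' : 8 * ((1 - w) * (1 - 2 * w) ^+ 2 * (1 - 3 * w)) <= (1 - 5 * w) * (37 / 20) ^+ 3.
  have w3 : 0 < w ^+ 3 by rewrite exprn_gt0.
  rewrite -(ler_pM2r w3) (le_trans h) // -mulrA -exprMn.
  by apply: ler_wpM2l => //; lra.
(* 0.108 is close to the minimiser of the difference of the two sides of h'. *)
have c0 : 0 <= (w - 108 / 1000) ^+ 2 by apply: sqr_ge0.
have c1 : 0 <= (1 - 7 * w) * (w - 108 / 1000) ^+ 2 by apply: mulr_ge0 => //; lra.
have w4 : 0 <= w ^+ 4 by apply: exprn_ge0.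
lra.
Qed.

(** The left side, 24 C(p, 4) / p^4 for w = 1/p, decreases in [w], so it is at least its value
    120/343 at 1/7. The bound from e_3 refutes this for a > 2/3, the one from e_4 for 0.514 <= a <=
    2/3; below that, [w] is replaced by its upper bound 20/37 a^2. *)
Lemma lagrangian_gap (R : realFieldType) (w a : R) :
  0 < w -> 7 * w <= 1 -> 0 <= a <= 1 -> 37 * w <= 20 * a ^+ 2 ->
  (a <= 2 / 3 ->
   (1 - w) * (1 - 2 * w) * (1 - 3 * w) <= (1 - a) ^+ 3 * (1 + 3 * a)) ->
  (1 - w) * (1 - 2 * w) * (1 - 3 * w) <= (1 - a) ^+ 2 * (1 + 2 * a) ->
  False.
Proof.
move=> w0 w1 /andP[a0 a1] wa h4 h3.
have gmono (u v : R) : 0 <= v -> v <= u -> 7 * u <= 1 -> (1 - u) * (1 - 2 * u) * (1 - 3 * u) <=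
    (1 - v) * (1 - 2 * v) * (1 - 3 * v).
  move=> v0 vu u1.
  apply: ler_pM; [apply: mulr_ge0; lra|lra| |lra].
  by apply: ler_pM; lra.
have g7 := gmono (1/7) w (ltW w0).
have {}g7 : 120 / 343 <= (1 - w) * (1 - 2 * w) * (1 - 3 * w).
  by apply: le_trans (g7 _ _); lra.
have [a23|a23] := leP a (2 / 3); last first.
  have : (1 - a) ^+ 2 * (1 + 2 * a) <= 7 / 27.
    have : 0 <= (a - 2 / 3) * ((1 - a) * (a + 1)) by apply: mulr_ge0; [lra|apply: mulr_ge0; lra].
    nra.
  lra.
have {h3}{}h4 := h4 a23.
(* 0.514 lies just below the square root of 37/140, so for smaller [a] the value 20/37 a^2 is at
   most 1/7, as [gmono] requires. *)
have [a514|a514] := leP (514 / 1000) a.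
  have : (1 - a) ^+ 3 * (1 + 3 * a) <= 295 / 1000.
    have f1 : (1 - a) ^+ 2 <= (486 / 1000) ^+ 2 by rewrite lerXn2r ?nnegrE; lra.
    have f2 : (1 - a) * (1 + 3 * a) <= 1236 / 1000 by nra.
    have : (1 - a) ^+ 2 * ((1 - a) * (1 + 3 * a)) <= (486 / 1000) ^+ 2 * (1236 / 1000).
      apply: ler_pM => //; first by rewrite exprn_ge0; lra.
      by apply: mulr_ge0; lra.
    lra.
  lra.
have := gmono (20 / 37 * a ^+ 2) w (ltW w0).
have a2 : a ^+ 2 <= (514 / 1000) ^+ 2 by rewrite lerXn2r ?nnegrE; lra.
move=> /(_ ltac:(lra) ltac:(lra)).
move=> /le_trans/(_ h4).
have : (1 - a) ^+ 3 * (1 + 3 * a) <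
    (1 - 20 / 37 * a ^+ 2) * (1 - 2 * (20 / 37 * a ^+ 2)) *
      (1 - 3 * (20 / 37 * a ^+ 2)).
  have a_gt0 : 0 < a.
    by rewrite lt0r a0 andbT; apply/eqP => aE; move: wa; rewrite aE expr0n /=; lra.
  (* This product is the difference of the two sides, with a^2 factored out. *)
  have : 0 < a ^+ 2 * (102 / 37 - 8 * a + (3 + 11 * (20 / 37) ^+ 2) * a ^+ 2
      - 6 * (20 / 37) ^+ 3 * a ^+ 4).
    apply: mulr_gt0; first by rewrite exprn_gt0.
    have : a ^+ 4 <= a ^+ 2 * (514 / 1000) ^+ 2.
      by rewrite (exprD a 2 2) ler_wpM2l // exprn_ge0.
    nra.
  lra.
lra.
Qed.

(** * Elementary symmetric polynomials and Newton's identities *)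

Definition elem_sym (R : comNzRingType) (I : finType) (A : {set I}) (x : I -> R) (r : nat) : R :=
  \sum_(e : {set I} | (e \subset A) && (#|e| == r)) \prod_(i in e) x i.

Definition power_sum (R : comNzRingType) (I : finType) (A : {set I}) (x : I -> R) (k : nat) : R :=
  \sum_(i in A) x i ^+ k.

Section ElemSym.
Variables (R : comNzRingType) (I : finType).
Implicit Types (A : {set I}) (x : I -> R).

Lemma elem_sym0 A x : elem_sym A x 0 = 1.
Proof.
rewrite /elem_sym (big_pred1 finset.set0) => [|e]; first by rewrite big_set0.
by rewrite cards_eq0 /=; case: eqP => [->|_]; rewrite ?finset.sub0set ?andbF.
Qed.

Lemma elem_sym_set0 x r : elem_sym finset.set0 x r.+1 = 0.
Proof.
apply: big1 => e /andP[]; rewrite finset.subset0 => /eqP-> /eqP.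
by rewrite cards0.
Qed.

Lemma elem_symU1 A x v r : v \notin A ->
  elem_sym (v |: A) x r.+1 = elem_sym A x r.+1 + x v * elem_sym A x r.
Proof.
move=> vA; rewrite /elem_sym (bigID (fun e : {set I} => v \in e)) /= addrC.
congr (_ + _).
  apply: eq_bigl => e; rewrite andbAC; congr andb.
  apply/idP/idP => [/andP[/fintype.subsetP eA ve]|eA].
    apply/fintype.subsetP => i ie; have := eA i ie; rewrite !inE.
    by case: eqP => // iv; rewrite iv (negPf ve) in ie *.
  by rewrite (fintype.subset_trans eA (finset.subsetUr _ _)) (contra (fintype.subsetP eA v)).
rewrite big_distrr /= (reindex_onto (fun e => v |: e) (fun e => e :\ v)) /=; last first.
  by move=> e /andP[_ ve]; rewrite finset.setD1K.
apply: eq_big => [e|e].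
  have [ve|ve] := boolP (v \in e).
    rewrite [RHS]andbC; apply/idP/idP => [/andP[_ /eqP E]|/andP[_ /fintype.subsetP/(_ v ve)]].
      by move: ve; rewrite -E !inE eqxx.
    by rewrite (negPf vA).
  rewrite cardsU1 ve add1n eqSS finset.setU11 andbT finset.setU1K // eqxx andbT; congr andb.
  apply/idP/idP => [/fintype.subsetP eA|/fintype.subsetP eA]; apply/fintype.subsetP => i.
    move=> ie; have := eA i; rewrite !inE ie orbT => /(_ isT).
    by case: eqP => // iv; rewrite iv (negPf ve) in ie.
  by rewrite !inE => /orP[->//|/eA->]; rewrite orbT.
move=> /andP[_ /eqP E].
by rewrite big_setU1 //=; rewrite -E !inE eqxx.
Qed.

Lemma power_sumU1 A x v k : v \notin A ->
  power_sum (v |: A) x k = x v ^+ k + power_sum A x k.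
Proof. by move=> vA; rewrite /power_sum big_setU1. Qed.

Lemma newton4 A x (e := elem_sym A x) (p := power_sum A x) :
  [/\ e 1%N = p 1%N,
      2 * e 2%N = p 1%N ^+ 2 - p 2%N,
      6 * e 3%N = p 1%N ^+ 3 - 3 * p 1%N * p 2%N + 2 * p 3%N &
      24 * e 4%N = p 1%N ^+ 4 - 6 * p 1%N ^+ 2 * p 2%N + 3 * p 2%N ^+ 2
                 + 8 * p 1%N * p 3%N - 6 * p 4%N].
Proof.
rewrite {}/e {}/p.
have [n] := ubnP #|A|; elim: n A => // n IHn A.
have [->|[v vA]] := finset.set_0Vmem A.
  by move=> _; rewrite /power_sum !big_set0 !elem_sym_set0; split; ring.
rewrite (cardsD1 v) vA => lt_n; have {lt_n}/IHn[E1 E2 E3 E4] : (#|A :\ v| < n)%N by [].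
rewrite -(finset.setD1K vA); set B := A :\ v in E1 E2 E3 E4 *.
have vB : v \notin B by rewrite !inE eqxx.
rewrite !elem_symU1 // !power_sumU1 // elem_sym0 !mulrDr.
split; first by rewrite E1; ring.
- by rewrite E2 E1; ring.
- have -> : 6 * (x v * elem_sym B x 2) = 3 * x v * (2 * elem_sym B x 2) by ring.
  by rewrite E3 E2; ring.
- have -> : 24 * (x v * elem_sym B x 3) = 4 * x v * (6 * elem_sym B x 3) by ring.
  by rewrite E4 E3; ring.
Qed.

End ElemSym.

(** * Bounds on e_3 and e_4 by power sums *)

Section Bounds.
Variables (R : realFieldType) (I : finType).
Implicit Types (A : {set I}) (x : I -> R).

(** Newton's identity and p_3 <= p_1 p_2 give 6 e_3 <= p_1^3 - p_1 p_2. *)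
Lemma elem_sym3_le A x : (forall i, 0 <= x i) ->
  6 * elem_sym A x 3 <= power_sum A x 1 ^+ 3.
Proof.
move=> x0; have [_ _ -> _] := newton4 A x.
have p2_ge0 : 0 <= power_sum A x 2 by apply: sumr_ge0 => i _; rewrite exprn_ge0.
have p1_ge0 : 0 <= power_sum A x 1 by apply: sumr_ge0 => i _; rewrite exprn_ge0.
have : power_sum A x 3 <= power_sum A x 1 * power_sum A x 2.
  rewrite /power_sum [leRHS]mulr_sumr; apply: ler_sum => i iA.
  rewrite (exprS (x i) 2) ler_wpM2r ?exprn_ge0 // (bigD1 i) //= expr1 lerDl.
  by apply: sumr_ge0 => j _; rewrite expr1.
have := mulr_ge0 p1_ge0 p2_ge0; lra.
Qed.

Section UnitSum.
Variables (A : {set I}) (x : I -> R) (a : R).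
Hypotheses (x0 : forall i, 0 <= x i) (x1 : power_sum A x 1 = 1).
Hypotheses (a0 : 0 <= a) (x2 : power_sum A x 2 = a ^+ 2).

Lemma le_norm2 i : i \in A -> x i <= a.
Proof.
move=> iA; rewrite -(@ler_pXn2r _ 2) ?nnegrE // -x2 /power_sum (bigD1 i) //= lerDl.
by apply: sumr_ge0 => j _; rewrite exprn_ge0.
Qed.

Lemma norm2_le1 : a <= 1.
Proof.
rewrite -(@ler_pXn2r _ 2) ?nnegrE // -x2 expr1n -x1; apply: ler_sum => i iA.
rewrite expr1 expr2 ler_piMr // -x1 /power_sum (bigD1 i) //= expr1 lerDl.
by apply: sumr_ge0 => j _; rewrite exprn_ge0.
Qed.

(** No weight exceeds [a], so p_3 <= a p_2 = a^3, and 1 - 3 a^2 + 2 a^3 factors as on the right. *)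
Lemma elem_sym3_norm2 : 6 * elem_sym A x 3 <= (1 - a) ^+ 2 * (1 + 2 * a).
Proof.
have [_ _ -> _] := newton4 A x.
have : power_sum A x 3 <= a * power_sum A x 2.
  rewrite /power_sum [leRHS]mulr_sumr; apply: ler_sum => i iA.
  by rewrite (exprS (x i) 2) ler_wpM2r ?exprn_ge0 // le_norm2.
rewrite x1 x2; lra.
Qed.

(** Bounding 8 p_3 - 6 p_4 by (8 a - 6 a^2) a^2 turns Newton's identity into 1 - 6 a^2 + 8 a^3 - 3
    a^4, which is the right side. *)
Lemma elem_sym4_norm2 : a <= 2 / 3 ->
  24 * elem_sym A x 4 <= (1 - a) ^+ 3 * (1 + 3 * a).
Proof.
move=> a23; have [_ _ _ ->] := newton4 A x.
(* y |-> 8 y - 6 y^2 increases up to y = 2/3, and each weight is at most a. *)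
have : 8 * power_sum A x 3 - 6 * power_sum A x 4 <= (8 * a - 6 * a ^+ 2) * power_sum A x 2.
  rewrite /power_sum !mulr_sumr -sumrB; apply: ler_sum => i iA.
  have xa := le_norm2 iA; have xi := x0 i.
  have -> : 8 * x i ^+ 3 - 6 * x i ^+ 4 = (8 * x i - 6 * x i ^+ 2) * x i ^+ 2 by ring.
  apply: ler_wpM2r; first by rewrite exprn_ge0.
  by rewrite -subr_ge0 (_ : _ - _ = (a - x i) * (8 - 6 * (a + x i))); [apply: mulr_ge0; lra|ring].
rewrite x1 x2; lra.
Qed.

End UnitSum.

(** Cauchy-Schwarz, from the nonnegative sum of (c f_j - S)^2 with c = |P|. *)
Lemma sum_sqr_le_card (J : finType) (P : {pred J}) (f : J -> R) :
  (\sum_(j in P) f j) ^+ 2 <= #|P|%:R * \sum_(j in P) f j ^+ 2.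
Proof.
set S := \sum_(j in P) f j.
have [P0|P0] := posnP #|P|.
  rewrite P0 mul0r /S big_pred0 ?expr0n // => j.
  by apply/negP => jP; have := card0_eq P0 j; rewrite jP.
have n0 : 0 < #|P|%:R :> R by rewrite ltr0n.
set c : R := #|P|%:R in n0 *.
have : 0 <= \sum_(j in P) (c * f j - S) ^+ 2 by apply: sumr_ge0 => j _; apply: sqr_ge0.
rewrite (eq_bigr (fun j => c ^+ 2 * f j ^+ 2 + (- (2 * c * S) * f j + S ^+ 2))); last first.
  by move=> j _; ring.
rewrite !big_split /= -!mulr_sumr sumr_const -[_ *+ #|_|]mulr_natl -/c -/S.
set Q := \sum_(j in P) f j ^+ 2.
rewrite (_ : _ + _ = c * (c * Q - S ^+ 2)); last by ring.
by rewrite pmulr_rge0 // subr_ge0.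
Qed.

End Bounds.

(** * Edge polynomials against elementary symmetric polynomials *)

Lemma ler_sum_sub (R : realFieldType) (J : finType) (P Q : pred J) (F : J -> R) :
  (forall j, P j -> Q j) -> (forall j, 0 <= F j) ->
  \sum_(j | P j) F j <= \sum_(j | Q j) F j.
Proof.
move=> PQ F0; rewrite [leRHS](bigID P) /= (eq_bigl P); last first.
  by move=> j; apply/andP/idP => [[]|Pj] //; split=> //; exact: PQ.
by rewrite lerDl; apply: sumr_ge0.
Qed.

Lemma edge_poly_le_elem_sym (R : realType) n r (G : {set {set 'I_n}}) (x : 'rV[R]_n) :
  uniform r G -> (forall i, 0 <= x ord0 i) ->
  edge_poly G x <= elem_sym [set: 'I_n]%SET (x ord0) r.
Proof.
move=> uG x0; apply: ler_sum_sub => e; last exact: prodr_ge0.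
by move=> eG; rewrite finset.subsetT uG /=.
Qed.

Lemma elem_sym_le_edge_poly (R : realType) n r (G : {set {set 'I_n}}) K (x : 'rV[R]_n) :
  is_clique r G K -> (forall i, 0 <= x ord0 i) ->
  elem_sym K (x ord0) r <= edge_poly G x.
Proof.
move=> cK x0; apply: ler_sum_sub => e; last exact: prodr_ge0.
by move=> /andP[eK /eqP er]; exact: cK.
Qed.

Lemma edge_poly_supp (R : realType) n r (G : {set {set 'I_n}}) (K : {set 'I_n})
    (x : 'rV[R]_n) :
  uniform r G -> is_clique r G K -> (forall i, i \notin K -> x ord0 i = 0) ->
  edge_poly G x = elem_sym K (x ord0) r.
Proof.
move=> uG cK xK; rewrite /edge_poly (bigID (fun e : {set 'I_n} => e \subset K)) /=.
rewrite [X in _ + X]big1 ?addr0 => [|e /andP[_ /fintype.subsetPn[i ie iK]]]; last first.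
  by rewrite (bigD1 i) //= xK // mul0r.
apply: eq_bigl => e; rewrite andbC; have [eK|//] := boolP (e \subset K).
by apply/idP/eqP => [|er]; [exact: uG|exact: cK].
Qed.

(** [enum_val] carries the r-subsets of the index type of [y] to those of [K], linking the complete
    graph's own vertex type to that of [G]. *)
Lemma edge_poly_complete (R : realType) n r (K : {set 'I_n}) (x : 'I_n -> R) (y : 'rV[R]_#|K|) :
  (forall j, y ord0 j = x (enum_val j)) ->
  edge_poly (complete r #|K|) y = elem_sym K x r.
Proof.
move=> yx; rewrite /elem_sym /edge_poly.
pose f (j : 'I_#|K|) : 'I_n := enum_val j.
have finj : injective f by exact: enum_val_inj.
have fsurj i : i \in K -> exists j, i = f j.
  by move=> iK; exists (enum_rank_in iK i); rewrite /f enum_rankK_in.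
have fK j : f j \in K by exact: enum_valP.
pose h (e : {set 'I_#|K|}) : {set 'I_n} := (f @: e)%SET.
rewrite (eq_bigl (mem (h @: complete r #|K|)%SET)); last first.
  move=> e /=; apply/idP/imsetP => [/andP[/fintype.subsetP eK er]|[e' + ->]].
    have E : e = h [set j | f j \in e]%SET.
      apply/finset.setP => i; apply/idP/imsetP => [ie|[j + ->]]; last by rewrite inE.
      by have [j ij] := fsurj i (eK i ie); exists j; rewrite // inE -ij.
    by exists [set j | f j \in e]%SET; rewrite // inE -(card_imset _ finj) -/(h _) -E.
  rewrite inE /h card_imset // => ->; rewrite andbT.
  by apply/fintype.subsetP => _ /imsetP[j _ ->].
rewrite big_imset /=; last by move=> ? ? _ _; exact: (imset_inj finj).
apply: eq_bigr => e _; rewrite /h big_imset /=; last by move=> ? ? _ _; exact: finj.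
by apply: eq_bigr => j _; rewrite yx.
Qed.

(** * Lagrangians of a graph and of its cliques *)

Lemma edge_poly_le_lagrangian (R : realType) n (G : {set {set 'I_n}}) (x : 'rV[R]_n) :
  std_simplex R n x -> edge_poly G x <= lagrangian R G.
Proof.
case: n G x => [|n] G x xS.
  (* For n = 0 the simplex is empty, since an empty sum is not 1. *)
  by case: xS => _; rewrite big_ord0 => /eqP; rewrite eq_sym oner_eq0.
by have [z _ [<-]] := lagrangian_max R G (ltn0Sn n); exact.
Qed.

(** An optimal weighting of the complete graph, extended by 0 outside [K], is admissible for [G]. *)
Lemma lagrangian_clique_le (R : realType) n r (G : {set {set 'I_n}}) (K : {set 'I_n}) :
  is_clique r G K -> (0 < #|K|)%N ->
  lagrangian R (complete r #|K|) <= lagrangian R G.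
Proof.
move=> cK K0; have [y [y0 y1] [<- _]] := lagrangian_max R (complete r #|K|) K0.
have [i0 i0K] : exists i, i \in K by apply/card_gt0P.
pose x : 'rV[R]_n := \row_i (if i \in K then y ord0 (enum_rank_in i0K i) else 0).
have yx j : y ord0 j = x ord0 (enum_val j).
  by rewrite mxE enum_valP enum_valK_in.
have x0 i : 0 <= x ord0 i by rewrite mxE; case: ifP.
rewrite (edge_poly_complete _ yx).
apply: le_trans (elem_sym_le_edge_poly cK x0) (edge_poly_le_lagrangian _ _).
split=> //; rewrite -y1 (bigID (mem K)) /= [X in _ + X]big1 ?addr0; last first.
  by move=> i iK; rewrite mxE (negPf iK).
by rewrite big_enum_val; apply: eq_bigr => j _; rewrite yx.
Qed.

Lemma lagrangian_le_clique (R : realType) n r (G : {set {set 'I_n}}) (K : {set 'I_n})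
    (x : 'rV[R]_n) :
  uniform r G -> is_clique r G K -> std_simplex R n x ->
  (forall i, i \notin K -> x ord0 i = 0) ->
  edge_poly G x <= lagrangian R (complete r #|K|).
Proof.
move=> uG cK [x0 x1] xK; rewrite (edge_poly_supp uG cK xK).
pose y : 'rV[R]_#|K| := \row_j x ord0 (enum_val j).
have yx j : y ord0 j = x ord0 (enum_val j) by rewrite mxE.
rewrite -(edge_poly_complete _ yx); apply: edge_poly_le_lagrangian.
split=> [j|]; first by rewrite yx.
rewrite -x1 [RHS](bigID (mem K)) /= [X in _ = _ + X]big1 ?addr0 //.
by rewrite [RHS]big_enum_val /=; apply: eq_bigr => j _; rewrite mxE.
Qed.

Lemma card_complete r p : #|complete r p| = 'C(p, r).
Proof. by rewrite card_draws card_ord. Qed.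

Lemma lagrangian_complete_ge (R : realType) r p : (0 < p)%N ->
  'C(p, r)%:R / p%:R ^+ r <= lagrangian R (complete r p).
Proof.
move=> p0; pose x : 'rV[R]_p := const_mx p%:R^-1.
have xS : std_simplex R p x.
  split=> [i|]; first by rewrite mxE invr_ge0.
  under eq_bigr do rewrite mxE.
  by rewrite sumr_const card_ord -[_ *+ p]mulr_natl divff // pnatr_eq0 -lt0n.
apply: le_trans (edge_poly_le_lagrangian _ xS); rewrite /edge_poly.
rewrite (eq_bigr (fun=> p%:R ^- r)) => [|e]; last first.
  rewrite inE => /eqP er; under eq_bigr do rewrite mxE.
  by rewrite prodr_const er exprVn.
by rewrite sumr_const card_complete mulr_natl.
Qed.

(** * Links and the optimality condition *)

(* The partial derivative of [edge_poly G] with respect to x_v. *)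
Definition link_poly (R : realType) n (G : {set {set 'I_n}}) (v : 'I_n) (x : 'I_n -> R) : R :=
  \sum_(e in G | v \in e) \prod_(i in e :\ v) x i.

(** Edges through [v] stay distinct after deleting [v], and become r-sets. *)
Lemma link_poly_le_elem_sym (R : realType) n r (G : {set {set 'I_n}}) v (x : 'I_n -> R) :
  uniform r.+1 G -> (forall i, 0 <= x i) ->
  link_poly G v x <= elem_sym [set: 'I_n]%SET x r.
Proof.
move=> uG x0; rewrite /link_poly.
pose F := [set e in G | v \in e]%SET.
rewrite (eq_bigl (mem F)) => [|e]; last by rewrite !inE.
have rem_inj : {in F &, injective (fun e : {set 'I_n} => e :\ v)}.
  move=> e f; rewrite !inE => /andP[_ ve] /andP[_ vf] E.
  by rewrite -(finset.setD1K ve) E finset.setD1K.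
rewrite -(big_imset (fun e : {set 'I_n} => \prod_(i in e) x i) rem_inj) /=.
apply: ler_sum_sub => e; last exact: prodr_ge0.
move=> /imsetP[f]; rewrite inE => /andP[fG vf] ->.
by rewrite finset.subsetT /= -eqSS -(uG f fG) (cardsD1 v f) vf.
Qed.

(** An edge contains [v] at most once, so the polynomial is affine in x_v with slope [link_poly]. *)
Lemma edge_poly_decr (R : realType) n (G : {set {set 'I_n}}) v (x : 'rV[R]_n) t :
  edge_poly G (x - t *: delta_mx 0 v) = edge_poly G x - t * link_poly G v (x ord0).
Proof.
have xE i : i != v -> (x - t *: delta_mx 0 v) ord0 i = x ord0 i.
  by move=> iv; rewrite !mxE (negPf iv) andbF mulr0 subr0.
have xv : (x - t *: delta_mx 0 v) ord0 v = x ord0 v - t.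
  by rewrite !mxE !eqxx mulr1.
rewrite /edge_poly /link_poly (bigID (fun e : {set 'I_n} => v \in e)) /=.
rewrite [in RHS](bigID (fun e : {set 'I_n} => v \in e)) /= addrAC; congr (_ + _); last first.
  apply: eq_bigr => e /andP[_ ve]; apply: eq_bigr => i ie; apply: xE.
  by apply: contraNneq ve => <-.
rewrite mulr_sumr -sumrB; apply: eq_bigr => e /andP[_ ve].
rewrite (finset.big_setD1 v) // [in RHS](finset.big_setD1 v) //= xv mulrBl; congr (_ * _ - _ * _).
  by apply: eq_bigr => i; rewrite !inE => /andP[/xE].
by apply: eq_bigr => i; rewrite !inE => /andP[/xE].
Qed.

Lemma edge_polyZ (R : realType) n r (G : {set {set 'I_n}}) (x : 'rV[R]_n) c :
  uniform r G -> edge_poly G (c *: x) = c ^+ r * edge_poly G x.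
Proof.
move=> uG; rewrite /edge_poly mulr_sumr; apply: eq_bigr => e eG.
under eq_bigr do rewrite mxE.
by rewrite big_split /= prodr_const uG.
Qed.

(* Lowering x_v by t and rescaling by 1 / (1 - t) stays in the simplex, so
   optimality gives l - t D <= l (1 - t)^4; compare first-order terms. *)
Lemma link_poly_ge (R : realType) n (G : {set {set 'I_n}}) v (x : 'rV[R]_n) :
  uniform 4 G -> std_simplex R n x -> edge_poly G x = lagrangian R G ->
  0 < x ord0 v -> 4 * edge_poly G x <= link_poly G v (x ord0).
Proof.
move=> uG [x0 x1] xmax xv; set l := edge_poly G x; set D := link_poly _ _ _.
rewrite leNgt; apply/negP => Dl.
have D0 : 0 <= D by apply: sumr_ge0 => e _; apply: prodr_ge0.
have l0 : 0 < l by lra.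
(* The first bound keeps x_v - t nonnegative. Optimality will give 4 l - D <= 6 l t, while the
   second bound makes 6 l t at most half of 4 l - D > 0. *)
pose t := Num.min (x ord0 v) ((4 * l - D) / (12 * l)).
have t0 : 0 < t by rewrite lt_min xv divr_gt0 //; lra.
have tx : t <= x ord0 v by rewrite ge_min lexx.
have t1 : t * (12 * l) <= 4 * l - D.
  by rewrite -ler_pdivlMr; [rewrite ge_min lexx orbT|lra].
have t13 : t < 1 / 2 by nra.
have c0 : 0 < 1 - t by lra.
have yS : std_simplex R n ((1 - t)^-1 *: (x - t *: delta_mx 0 v)).
  split=> [i|].
    rewrite mxE mulr_ge0 ?invr_ge0 ?(ltW c0) // !mxE eqxx /=.
    by case: eqP => [->|_]; rewrite ?mulr1 ?mulr0 ?subr0 // subr_ge0.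
  under eq_bigr do rewrite mxE.
  rewrite -mulr_sumr.
  under eq_bigr do rewrite !mxE eqxx /=.
  rewrite sumrB x1 -mulr_sumr (bigD1 v) //= eqxx big1 => [|i /negPf->//].
  by rewrite addr0 mulr1 mulVf // gt_eqF.
have := edge_poly_le_lagrangian G yS.
rewrite (edge_polyZ _ _ uG) edge_poly_decr -xmax -/l -/D exprVn.
rewrite mulrC ler_pdivrMr ?exprn_gt0 // => h.
have : (1 - t) ^+ 4 <= 1 - 4 * t + 6 * t ^+ 2 by nra.
move=> /(ler_wpM2l (ltW l0)); nra.
Qed.

(** * Size of the link and the resulting bound on its polynomial *)

(** The C(|K|, r) edges inside [K] all avoid [v], so at most [s] edges are left that could contain
    it. *)
Lemma card_link_le n (G : {set {set 'I_n}}) (K : {set 'I_n}) v s r :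
  is_clique r G K -> v \notin K -> (#|G| <= 'C(#|K|, r) + s)%N ->
  (#|[set e in G | v \in e]%SET| <= s)%N.
Proof.
move=> cK vK; rewrite -cards_draws.
set F := [set e | _]%SET; set C := [set e | _]%SET => Gs.
have CG : (C \subset G)%SET.
  by apply/fintype.subsetP => e; rewrite inE => /andP[eK /eqP er]; exact: cK.
have FG : (F \subset G :\: C)%SET.
  apply/fintype.subsetP => e; rewrite !inE => /andP[-> ve]; rewrite andbT negb_and.
  by rewrite (contra _ vK) // => /fintype.subsetP; exact.
apply: leq_trans (subset_leq_card FG) _.
by rewrite cardsD (finset.setIidPr CG) leq_subLR.
Qed.

Lemma natr_bin_left (R : comNzRingType) n m :
  m.+1%:R * 'C(n, m.+1)%:R = (n%:R - m%:R) * 'C(n, m)%:R :> R.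
Proof.
have [mn|nm] := leqP m n; first by rewrite -natrB // -!natrM mul_bin_left.
by rewrite !bin_small ?mulr0 // ltnW.
Qed.

Lemma natr_bin3 (R : comNzRingType) n :
  6 * 'C(n, 3)%:R = n%:R * (n%:R - 1) * (n%:R - 2) :> R.
Proof.
have h1 := natr_bin_left R n 1; have h2 := natr_bin_left R n 2.
by rewrite (_ : 6 = 2 * 3) -?mulrA ?h2 1?mulrCA ?h1 ?bin1; ring.
Qed.

Lemma natr_bin4 (R : comNzRingType) n :
  24 * 'C(n, 4)%:R = n%:R * (n%:R - 1) * (n%:R - 2) * (n%:R - 3) :> R.
Proof.
have h3 := natr_bin_left R n 3.
by rewrite -natr_bin3 (_ : 24 = 6 * 4) -?mulrA ?h3; ring.
Qed.

(** 48 C(q, 3) = 2q (2q - 2) (2q - 4) with 2q <= p - 1; p >= 7 gives q >= 3, so all factors are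
    nonnegative. *)
Lemma bin3_half_le (R : realFieldType) p : (7 <= p)%N ->
  48 * 'C((p - 1) %/ 2, 3)%:R <= (p%:R - 1) * (p%:R - 3) * (p%:R - 5) :> R.
Proof.
move=> p7; set q := (_ %/ 2)%N.
have q3 : (3 <= q)%N by rewrite /q; lia.
have qp : (2 * q < p)%N by rewrite /q; lia.
have {}q3 : 3 <= q%:R :> R by rewrite (ler_nat R 3).
have {}qp : 2 * q%:R + 1 <= p%:R :> R by rewrite -natrM natr1 ler_nat.
have -> : 48 * 'C(q, 3)%:R = 2 * q%:R * (2 * q%:R - 2) * (2 * q%:R - 4) :> R.
  by rewrite (_ : 48 = 8 * 6) -?mulrA ?natr_bin3; ring.
apply: ler_pM; [apply: mulr_ge0; lra|lra| |lra].
by apply: ler_pM; lra.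
Qed.

(** Cauchy-Schwarz over the edges through [v] leaves the link polynomial of the squared weights,
    which is at most e_3(x^2), and 6 e_3(x^2) <= p_1(x^2)^3 = p_2(x)^3. *)
Lemma link_poly_sqr_le (R : realType) n (G : {set {set 'I_n}}) v (x : 'I_n -> R) :
  uniform 4 G -> (forall i, 0 <= x i) ->
  6 * link_poly G v x ^+ 2 <=
  #|[set e in G | v \in e]%SET|%:R * power_sum [set: 'I_n]%SET x 2 ^+ 3.
Proof.
move=> uG x0; set F := [set e in G | v \in e]%SET.
have x20 i : 0 <= x i ^+ 2 by rewrite exprn_ge0.
have <- : power_sum [set: 'I_n]%SET (fun i => x i ^+ 2) 1 = power_sum [set: 'I_n]%SET x 2.
  by apply: eq_bigr => i _; rewrite expr1.
apply: le_trans (ler_wpM2l _ (elem_sym3_le _ x20)) => //.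
rewrite [leRHS]mulrCA ler_wpM2l //.
apply: le_trans (ler_wpM2l _ (link_poly_le_elem_sym v uG x20)) => //.
rewrite /link_poly (eq_bigl (mem F)) => [|e]; last by rewrite !inE.
rewrite [X in _ * X](eq_bigl (mem F)) => [|e]; last by rewrite !inE.
apply: le_trans (sum_sqr_le_card _ _) _; rewrite ler_wpM2l //.
by apply: ler_sum => e _; rewrite prodrXl.
Qed.

(** * Combining optimality, counting and the numerical bounds *)

Theorem theorem4p3 (R : realType) (m t n : nat) (G : {set {set 'I_n}})
    (m_gt0 : (0 < m)%N) (t_gt0 : (0 < t)%N)
    (m_ge : ('C(t - 1, 4) <= m)%N)
    (m_le : (m <= 'C(t - 1, 4) + 'C((t - 2) %/ 2, 3))%N)
    (G_unif : uniform 4 G) (G_size : #|G| = m)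
    (G_clique : has_clique 4 G (t - 1)) :
  lagrangian R G = lagrangian R (complete 4 (t - 1)).
Proof.
have [K Kp cK] := G_clique; rewrite -Kp.
(* If t - 1 <= 3, both binomials in [m_le] vanish, contradicting [m_gt0]. *)
have p4 : (4 <= #|K|)%N.
  rewrite leqNgt Kp; apply/negP => p3; move: m_le.
  by rewrite !bin_small //; lia.
have K_gt0 : (0 < #|K|)%N by apply: leq_trans p4.
have n_gt0 : (0 < n)%N by rewrite -[n]card_ord (leq_trans K_gt0) ?max_card.
apply/eqP; rewrite eq_le lagrangian_clique_le // andbT.
have [x xS [xmax _]] := lagrangian_max R G n_gt0.
have [/forallP xK|] := boolP [forall i, (i \notin K) ==> (x ord0 i == 0)].
  rewrite -xmax; apply: lagrangian_le_clique => // i iK.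
  by apply/eqP/(implyP (xK i)).
rewrite negb_forall => /existsP[v]; rewrite negb_imply => /andP[vK xv].
have [x0 x1] := xS; exfalso.
have {}xv : 0 < x ord0 v by rewrite lt0r xv x0.
set l := edge_poly G x in xmax.
have l_ge : 'C(#|K|, 4)%:R / #|K|%:R ^+ 4 <= l.
  by rewrite xmax (le_trans _ (lagrangian_clique_le R cK K_gt0)) // lagrangian_complete_ge.
have l_gt0 : 0 < l.
  by apply: lt_le_trans l_ge; rewrite divr_gt0 ?exprn_gt0 ?ltr0n ?bin_gt0.
have D_ge := link_poly_ge G_unif xS xmax xv; rewrite -/l in D_ge.
pose A := [set: 'I_n]%SET.
pose a : R := Num.sqrt (power_sum A (x ord0) 2).
have a0 : 0 <= a by exact: sqrtr_ge0.
have X2 : power_sum A (x ord0) 2 = a ^+ 2.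
  by rewrite sqr_sqrtr // sumr_ge0 // => i _; rewrite exprn_ge0.
have X1 : power_sum A (x ord0) 1 = 1.
  by rewrite -x1; apply: eq_big => [i|i _]; rewrite ?inE ?expr1.
have D_le := link_poly_sqr_le v G_unif x0; rewrite X2 in D_le.
pose s := 'C((#|K| - 1) %/ 2, 3).
have F_le : (#|[set e in G | v \in e]%SET| <= s)%N.
  by apply: card_link_le cK vK _; rewrite G_size /s Kp -subnDA.
have {F_le}D_sqr : 6 * (4 * l) ^+ 2 <= s%:R * (a ^+ 2) ^+ 3.
  apply: le_trans (_ : 6 * link_poly G v (x ord0) ^+ 2 <= _).
    by rewrite ler_wpM2l // lerXn2r ?nnegrE //; lra.
  by apply: le_trans D_le _; rewrite ler_wpM2r ?ler_nat // !exprn_ge0.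
(* For |K| <= 6 the floor of (|K| - 1) / 2 is at most 2, so s = 0 and [D_sqr] contradicts l > 0. *)
have [p6|p7] := leqP #|K| 6.
  move: D_sqr; rewrite /s bin_small; last by lia.
  by rewrite mul0r; nra.
have p_ge : 7 <= #|K|%:R :> R by rewrite (ler_nat R 7).
pose w : R := #|K|%:R^-1.
have pn0 : #|K|%:R != 0 :> R by rewrite pnatr_eq0 -lt0n.
have pw : #|K|%:R * w = 1 by rewrite divff.
have w_gt0 : 0 < w by rewrite invr_gt0; lra.
have w7 : 7 * w <= 1 by nra.
have l_gew : (1 - w) * (1 - 2 * w) * (1 - 3 * w) <= 24 * l.
  have -> : (1 - w) * (1 - 2 * w) * (1 - 3 * w) = 24 * ('C(#|K|, 4)%:R / #|K|%:R ^+ 4).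
    by rewrite mulrA natr_bin4 /w; field.
  by rewrite ler_wpM2l.
have s_le : 48 * s%:R * w ^+ 3 <= (1 - w) * (1 - 3 * w) * (1 - 5 * w).
  have -> : (1 - w) * (1 - 3 * w) * (1 - 5 * w) =
      (#|K|%:R - 1) * (#|K|%:R - 3) * (#|K|%:R - 5) * w ^+ 3.
    by rewrite /w; field.
  by rewrite ler_wpM2r ?exprn_ge0 ?bin3_half_le // ltW.
have wa : 37 * w <= 20 * a ^+ 2.
  apply: second_moment_ge; rewrite ?exprn_ge0 //; first exact: ltW.
  (* This factor turns the left side into the square of the lower bound on 24 l and the right side
     into the bound of [s_le]; [D_sqr] links the two, as 8 (24 l)^2 = 48 * 6 (4 l)^2. *)
  have w13 : 0 < (1 - w) * (1 - 3 * w) by apply: mulr_gt0; lra.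
  rewrite -(ler_pM2l w13).
  apply: le_trans (_ : 8 * (24 * l) ^+ 2 * w ^+ 3 <= _).
    rewrite [leLHS](_ : _ = 8 * ((1 - w) * (1 - 2 * w) * (1 - 3 * w)) ^+ 2 * w ^+ 3); last by ring.
    rewrite ler_wpM2r ?exprn_ge0 ?(ltW w_gt0) // ler_wpM2l // lerXn2r ?nnegrE //; last by lra.
    by apply: mulr_ge0; [apply: mulr_ge0; lra|lra].
  rewrite [leRHS]mulrA; apply: le_trans (ler_wpM2r _ s_le); last by rewrite !exprn_ge0.
  rewrite [leLHS](_ : _ = 48 * w ^+ 3 * (6 * (4 * l) ^+ 2)); last by ring.
  rewrite [leRHS](_ : _ = 48 * w ^+ 3 * (s%:R * (a ^+ 2) ^+ 3)); last by ring.
  by rewrite ler_wpM2l // mulr_ge0 ?exprn_ge0 ?(ltW w_gt0).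
apply: (lagrangian_gap w_gt0 w7 _ wa) => [|a23|].
- by rewrite a0; exact: norm2_le1 x0 X1 a0 X2.
- apply: le_trans (elem_sym4_norm2 x0 X1 a0 X2 a23); apply: le_trans l_gew _.
  by rewrite ler_wpM2l // edge_poly_le_elem_sym.
(* The bound used when a > 2/3 comes through the link: 4 l <= D <= e_3(x). *)
- apply: le_trans (elem_sym3_norm2 x0 X1 a0 X2); apply: le_trans l_gew _.
  rewrite (_ : 24 * l = 6 * (4 * l)); last by ring.
  by rewrite ler_wpM2l // (le_trans D_ge) // link_poly_le_elem_sym.
Qed.
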